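(* Let $\Gamma=\langle \gamma_1,\ldots,\gamma_n \mid r_l,\ l\in L\rangle$ be a finitely generated group, where the index set $L$ of relators may be infinite, and let $\pi\colon \mathbb F_n\to\Gamma$ be the natural surjection from the free group on $\gamma_1,\dots,\gamma_n$. Then the homomorphism $B(\mathbb F_n)\to B(\Gamma)$ induced by $\pi$ is surjective and induces an isomorphism of $\mathbb C$-algebras $$B(\Gamma)\cong B(\mathbb F_n)\big/\big(t_{r_l}-2,\ t_{\gamma_i r_l}-t_{\gamma_i},\ t_{\gamma_j\gamma_k r_l}-t_{\gamma_j\gamma_k}\ \big|\ l\in L,\ 1\le i\le n,\ 1\le j<k\le n\big).$$
   Context: For a finitely generated group $\Gamma$ with generators $\gamma_1,\dots,\gamma_n$, the universal $\mathrm{SL}_2(\mathbb C)$-representation algebra $A(\Gamma)$ is the quotient of the polynomial ring $\mathbb C[x^{(k)}_{ij}]$ ($1\le i,j\le 2$, $1\le k\le n$) by the ideal generated by $\det X^{(k)}-1$ ($X^{(k)}=(x^{(k)}_{ij})$) and by the entries of $r(X^{(1)},\dots,X^{(n)})-I$ for all relators $r$. The group $\mathrm{SL}_2(\mathbb C)$ acts on $A(\Gamma)$ by simultaneous conjugation, and $B(\Gamma)=A(\Gamma)^{\mathrm{SL}_2(\mathbb C)}$ is the universal algebra of $\mathrm{SL}_2(\mathbb C)$-characters (coordinate ring of the character scheme $X(\Gamma,\mathrm{SL}_2(\mathbb C))=(\mathrm{Spm}\,B(\Gamma),B(\Gamma))$, which may be non-reduced). For $\gamma\in\Gamma$ represented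 by a word $w_\gamma$, the trace function $t_\gamma\in B(\Gamma)$ is the class of $\operatorname{tr}\big(w_\gamma(X^{(1)},\dots,X^{(n)})\big)$. For $\mathbb F_n$ there are no relators, and $t_w\in B(\mathbb F_n)$ for any word $w$. *)

(* Defs.v *)
From HB Require Import structures.
From mathcomp Require Import all_boot all_order all_algebra.
From mathcomp Require Import mpoly.
From mathcomp Require Import complex.
From mathcomp Require Import Rstruct.
From Stdlib Require Import Rdefinitions.

Set Implicit Arguments.
Unset Strict Implicit.
Unset Printing Implicit Defensive.

Import GRing.Theory.
Local Open Scope ring_scope.

Definition CC : Type := complex Rdefinitions.R.

Definition Pol (n : nat) := {mpoly CC[n * (2 * 2)]}.

Definition var_idx (n : nat) (k : 'I_n) (i j : 'I_2) : 'I_(n * (2 * 2)) :=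
  mxvec_index k (mxvec_index i j).

Definition Xg (n : nat) (k : 'I_n) : 'M[Pol n]_2 :=
  \matrix_(i, j) 'X_(var_idx k i j).

(* Words in the free group F_n on gamma_1..gamma_n: a letter (k, false) is
   gamma_k, a letter (k, true) is gamma_k^{-1}. *)
Definition word (n : nat) := seq ('I_n * bool).

(* Evaluation of a word at the generic matrices; the inverse of X^(k) is
   represented by its adjugate (equal to the inverse modulo det X^(k) - 1). *)
Definition letter_mx (n : nat) (a : 'I_n * bool) : 'M[Pol n]_2 :=
  if a.2 then \adj (Xg a.1) else Xg a.1.

Definition eval_word (n : nat) (w : word n) : 'M[Pol n]_2 :=
  foldr (fun a M => letter_mx a *m M) 1%:M w.

Definition trw (n : nat) (w : word n) : Pol n := \tr (eval_word w).

Definition in_ideal (n : nat) (S : Pol n -> Prop) (f : Pol n) : Prop :=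
  exists (m : nat) (c s : 'I_m -> Pol n),
    (forall i, S (s i)) /\ f = \sum_(i < m) c i * s i.

Definition relF (n : nat) (f : Pol n) : Prop :=
  exists k : 'I_n, f = \det (Xg k) - 1.

Definition relG (n : nat) (L : Type) (r : L -> word n) (f : Pol n) : Prop :=
  relF f \/ exists (l : L) (i j : 'I_2), f = (eval_word (r l) - 1%:M) i j.

(* Simultaneous conjugation action of g in SL2(C) on C[x]:
   x^(k)_ij |-> (g X^(k) g^{-1})_ij (g^{-1} = adj g since det g = 1). *)
Definition conj_mx (n : nat) (g : 'M[CC]_2) (k : 'I_n) : 'M[Pol n]_2 :=
  map_mx (fun c : CC => c%:MP) g *m Xg k *m map_mx (fun c : CC => c%:MP) (\adj g).

Definition act_tuple (n : nat) (g : 'M[CC]_2) : (n * (2 * 2)).-tuple (Pol n) :=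
  [tuple (mxvec (\matrix_(k < n, ij < 2 * 2) mxvec (conj_mx g k) 0 ij) 0 v)
   | v < n * (2 * 2)].

Definition act (n : nat) (g : 'M[CC]_2) (f : Pol n) : Pol n :=
  f \mPo @act_tuple n g.

(* f represents an element of A^{SL2(C)} = B, where A = C[x]/(ideal gen. by S):
   its class is fixed by every g in SL2(C). *)
Definition inv_mod (n : nat) (S : Pol n -> Prop) (f : Pol n) : Prop :=
  forall g : 'M[CC]_2, \det g = 1 -> in_ideal S (act g f - f).

Definition gen (n : nat) (i : 'I_n) : word n := [:: (i, false)].

Definition kernel_gen (n : nat) (L : Type) (r : L -> word n) (t : Pol n) : Prop :=
  exists l : L,
    t = trw (r l) - 2%:R
    \/ (exists i : 'I_n, t = trw (gen i ++ r l) - trw (gen i))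
    \/ (exists j k : 'I_n, ltn j k /\
          t = trw (gen j ++ gen k ++ r l) - trw (gen j ++ gen k)).

(* Main.v *)
Require Import Defs.
From HB Require Import structures.
From mathcomp Require Import all_boot all_order all_algebra.
From mathcomp Require Import mpoly complex Rstruct ring zify.

Set Implicit Arguments.
Unset Strict Implicit.
Unset Printing Implicit Defensive.
Import Order.TTheory GRing.Theory Num.Theory.
Local Open Scope ring_scope.

(* Averaging over SL_2 against the Haar functional of its coordinate ring projects
   onto invariants; this gives surjectivity.  In bounded degree the functional is a
   finite weighted sum of evaluations at points of SL_2, so averages stay in every
   ideal that contains the differences g.f - f.  If f is an invariant combination
   of entries of r_l - 1, averaging writes f through averages of products
   c (r_l - 1)_ij.  Writing g X g^-1 through the bilinear form g (X eps) g^T, the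
   Haar functional contracts pairs of rows of g; the contractions produce traces of
   words times one factor tr(w (r_l - 1)).  By the Cayley-Hamilton identities
   w reduces to 1, X_i, X_j X_k with j < k over the invariants, which leaves exactly
   the listed generators. *)

(** * Two-by-two matrices *)

Lemma ord2P (i : 'I_2) : i = 0 \/ i = 1.
Proof. by case: i => [[|[|]]] // ?; [left|right]; apply: val_inj. Qed.

Lemma big_ord2 (V : Type) (idx : V) (op : Monoid.law idx) (f : 'I_2 -> V) :
  \big[op/idx]_i f i = op (f 0) (f 1).
Proof.
rewrite big_ord_recl big_ord1; congr (op _ (f _)); exact: val_inj.
Qed.

Lemma rev_ord2 : (rev_ord 0 = 1 :> 'I_2) * (rev_ord 1 = 0 :> 'I_2).
Proof. by split; apply: val_inj. Qed.

Lemma matrix22P (K : Type) (A B : 'M[K]_2) :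
  A 0 0 = B 0 0 -> A 0 1 = B 0 1 -> A 1 0 = B 1 0 -> A 1 1 = B 1 1 -> A = B.
Proof.
move=> e00 e01 e10 e11; apply/matrixP => i j.
by have [-> | ->] := ord2P i; have [-> | ->] := ord2P j.
Qed.

(** The symplectic form with rows (0, 1) and (-1, 0). The adjugate is the adjoint for it, so it
    trades [g^-1] for [g^T] and turns an entry of a conjugate into a bilinear form in two rows of
    [g]. *)
Definition eps_mx (K : pzRingType) : 'M[K]_2 :=
  \matrix_(i, j) ((i < j)%N%:R - (j < i)%N%:R).

Lemma adj_mx22 (K : comNzRingType) (A : 'M[K]_2) :
  \adj A = (eps_mx K)^T *m A^T *m eps_mx K.
Proof.
have l i j : (lift (i : 'I_2) (j : 'I_1) = rev_ord i).
  by rewrite [j]ord1; have [-> | ->] := ord2P i; apply: val_inj.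
apply: matrix22P; rewrite !(mxE, big_ord2) /cofactor det_mx11 !mxE !l !rev_ord2 /=; ring.
Qed.

Lemma adjM22 (K : comNzRingType) (A B : 'M[K]_2) :
  \adj (A *m B) = \adj B *m \adj A.
Proof.
by rewrite !adj_mx22; apply: matrix22P; rewrite !(mxE, big_ord2) /=; ring.
Qed.

Lemma adjK22 (K : comNzRingType) (A : 'M[K]_2) : \adj (\adj A) = A.
Proof.
by rewrite !adj_mx22; apply: matrix22P; rewrite !(mxE, big_ord2) /=; ring.
Qed.

Lemma trace_mx22 (K : nzRingType) (A : 'M[K]_2) : \tr A = A 0 0 + A 1 1.
Proof. by rewrite /mxtrace big_ord2. Qed.

Lemma adj_trace22 (K : comNzRingType) (A : 'M[K]_2) : \adj A = (\tr A)%:M - A.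
Proof.
by rewrite adj_mx22 trace_mx22; apply: matrix22P; rewrite !(mxE, big_ord2) /=; ring.
Qed.

Lemma det_mx22 (K : comNzRingType) (A : 'M[K]_2) :
  \det A = A 0 0 * A 1 1 - A 0 1 * A 1 0.
Proof.
rewrite (expand_det_row _ 0) big_ord_recl big_ord1 /cofactor !det_mx11 !mxE /=.
have -> : lift ord0 ord0 = 1 :> 'I_2 by apply: val_inj.
have -> : lift 1 0 = 0 :> 'I_2 by apply: val_inj.
by rewrite expr0 mul1r expr1 mulN1r mulrN.
Qed.

Lemma sqr_mx22 (K : comNzRingType) (A : 'M[K]_2) :
  A *m A = \tr A *: A - \det A *: 1%:M.
Proof.
by rewrite det_mx22 trace_mx22; apply: matrix22P; rewrite !(mxE, big_ord2) /=; ring.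
Qed.

(** Polarized Cayley-Hamilton: two factors are exchanged at the cost of shorter products with trace
    coefficients. *)
Lemma swap_mx22 (K : comNzRingType) (A B : 'M[K]_2) :
  A *m B = \tr A *: B + \tr B *: A + (\tr (A *m B) - \tr A * \tr B) *: 1%:M -
    B *m A.
Proof.
by rewrite !trace_mx22; apply: matrix22P; rewrite !(mxE, big_ord2) /=; ring.
Qed.

(* With [S(X, Y) = XY + YX], which the polarized Cayley-Hamilton identity puts in the
   span of [X], [Y], [1], one has [2ABC = S(A, BC) - B S(C, A) + S(A, B) C]. *)
Lemma triple_mx22 (K : comNzRingType) (A B C : 'M[K]_2) :
  2%:R *: (A *m (B *m C)) =
    \tr A *: (B *m C) + \tr (B *m C) *: A + \tr B *: (A *m C) +
    (- \tr C) *: (B *m A) + (\tr C * \tr A - \tr (A *m C)) *: B +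
    (\tr (A *m B) - \tr A * \tr B) *: C +
    (\tr (A *m (B *m C)) - \tr A * \tr (B *m C)) *: 1%:M.
Proof.
by rewrite !trace_mx22; apply: matrix22P; rewrite !(mxE, big_ord2) /=; ring.
Qed.

(** Cyclicity together with [\tr (\adj M) = \tr M]. It moves the adjugate off a matrix [A] that need
    not be a word. *)
Lemma trace_adj_swap (K : comNzRingType) (A B C : 'M[K]_2) :
  \tr (C *m (\adj A *m B)) = \tr (\adj (B *m C) *m A).
Proof. by rewrite !adj_mx22 !trace_mx22 !(mxE, big_ord2) /=; ring. Qed.

Lemma conjM_mx (K : pzSemiRingType) (m : nat) (g v A B : 'M[K]_m) :
  v *m g = 1%:M -> g *m (A *m B) *m v = g *m A *m v *m (g *m B *m v).
Proof. by move=> vg; rewrite !mulmxA -(mulmxA _ v g) vg mulmx1. Qed.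

(** * The Haar functional of SL_2 as a quadrature *)

(** The nodes 1, ..., K are distinct in characteristic zero, so the Vandermonde system for the
    weights is solvable. *)
Lemma moment_weights (F : numFieldType) (K : nat) (c : nat -> F) :
  exists mu : 'I_K -> F, forall e, (e < K)%N ->
    \sum_(m < K) mu m * (m.+1)%:R ^+ e = c e.
Proof.
pose a : 'rV[F]_K := \row_m (m.+1)%:R.
have uV : Vandermonde K a \in unitmx.
  rewrite unitmxE det_Vandermonde unitfE; apply/prodf_neq0 => i _.
  apply/prodf_neq0 => j ltij; rewrite !mxE subr_eq0 eqr_nat.
  by rewrite eqSS; move: ltij; rewrite ltnNge; apply: contra => /eqP ->.
pose v : 'cV[F]_K := invmx (Vandermonde K a) *m \col_e c e.
exists (fun m => v m 0) => e ltK.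
have /matrixP/(_ (Ordinal ltK) 0) : Vandermonde K a *m v = \col_e c e.
  by rewrite mulKVmx.
rewrite [LHS]mxE [RHS]mxE /= => <-; apply: eq_bigr => m _.
by rewrite !mxE mulrC.
Qed.

(* The integral of [x ^ i (x - 1) ^ j] over [0, 1]. *)
Definition haar_value (F : fieldType) (i j : nat) : F :=
  (-1) ^+ j * (i`! * j`!)%:R / (i + j).+1`!%:R.

Lemma interval_weights (F : numFieldType) (K : nat) :
  exists mu : 'I_K -> F, forall i j, (i + j < K)%N ->
    \sum_(m < K) mu m * ((m.+1)%:R ^+ i * ((m.+1)%:R - 1) ^+ j) =
    haar_value F i j.
Proof.
(* The moments of [0, 1] are 1/(e + 1); the powers of x - 1 follow by induction from x^i (x-1)^(j+1)
   = x^(i+1) (x-1)^j - x^i (x-1)^j. *)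
have [mu muE] := moment_weights K (fun e => (e.+1)%:R^-1 : F).
exists mu => i j; elim: j i => [|j IHj] i ltK.
  under eq_bigr do rewrite expr0 mulr1.
  rewrite addn0 in ltK; rewrite muE // /haar_value expr0 mul1r muln1 addn0.
  rewrite factS natrM invfM mulrCA mulfV ?mulr1 //.
  by rewrite pnatr_eq0 -lt0n fact_gt0.
have -> : haar_value F i j.+1 = haar_value F i.+1 j - haar_value F i j.
  rewrite /haar_value !addnS addSn !factS exprS !natrM.
  have f0 : (i + j)`!%:R != 0 :> F by rewrite pnatr_eq0 -lt0n fact_gt0.
  have f1 : (i + j).+1%:R != 0 :> F by rewrite pnatr_eq0.
  have f2 : (i + j).+2%:R != 0 :> F by rewrite pnatr_eq0.
  rewrite -!natr1 in f1 f2 *.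
  by rewrite natrD in f1 f2 *; field; rewrite f0 f1 f2.
rewrite -!IHj; [|lia..].
rewrite -sumrB; apply: eq_bigr => m _; rewrite !exprS.
by move: (_ ^+ i) (_ ^+ j) => p q; ring.
Qed.

(** A discrete substitute for integration over the circle: it extracts the constant term of Laurent
    polynomials with exponents between -2N and 2N. Multiplying by t^(2N) makes the exponents
    nonnegative, hence the 4N + 1 nodes and the indicator of 2N as prescribed moments. *)
Lemma torus_weights (F : numFieldType) (N : nat) :
  exists mu : 'I_(4 * N).+1 -> F, forall p q, (p <= 2 * N)%N -> (q <= 2 * N)%N ->
    \sum_m mu m * ((m.+1)%:R ^+ p * (m.+1)%:R^-1 ^+ q) = (p == q)%:R.
Proof.
have [mu muE] := moment_weights (4 * N).+1 (fun e => (e == 2 * N)%N%:R : F).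
exists (fun m => mu m * (m.+1)%:R ^+ (2 * N)) => p q lep leq.
transitivity (\sum_(m < (4 * N).+1) mu m * (m.+1)%:R ^+ (2 * N + p - q)).
  apply: eq_bigr => m _; have m0 : (m.+1)%:R != 0 :> F by rewrite pnatr_eq0.
  rewrite -mulrA; congr (_ * _); rewrite exprVn mulrA.
  apply: (canLR (mulfK _)); rewrite ?expf_neq0 // -!exprD.
  have -> : (2 * N + p - q + q = 2 * N + p)%N by lia.
  by [].
rewrite muE; last lia.
by congr (nat_of_bool _)%:R; lia.
Qed.

(* The product [diag(t, 1/t) [[x, x - 1], [1, 1]] diag(u, 1/u)]: averaging over the two
   tori and integrating over [x] in [0, 1] computes the Haar functional. *)
Definition sl2_point (F : fieldType) (t u x : F) : 'M[F]_2 :=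
  \matrix_(i, j) if i == 0 then if j == 0 then t * u * x else t / u * (x - 1)
                 else if j == 0 then u / t else (t * u)^-1.

Lemma det_sl2_point (F : fieldType) (t u x : F) :
  t != 0 -> u != 0 -> \det (sl2_point t u x) = 1.
Proof. by move=> t0 u0; rewrite det_mx22 !mxE /=; field; rewrite t0 u0. Qed.

(* The Haar functional at [a ^ i b ^ j c ^ k d ^ l], where [ad - bc = 1]. *)
Definition haar_moment (F : fieldType) (i j k l : nat) : F :=
  ((i == l) && (j == k))%:R * haar_value F i j.

(** Degree 2N is what a product of N entries of conjugates requires, each entry being quadratic in
    [g]. *)
Definition haar_exact (F : numFieldType) (T : finType) (w : T -> F)
    (g : T -> 'M[F]_2) (N : nat) : Prop :=
  forall i j k l, (i + j + k + l <= 2 * N)%N ->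
    \sum_a w a * (g a 0 0 ^+ i * g a 0 1 ^+ j * g a 1 0 ^+ k * g a 1 1 ^+ l) =
    haar_moment F i j k l.

Lemma sum_prod3 (K : pzSemiRingType) (I J H : finType)
    (a : I -> K) (b : J -> K) (c : H -> K) :
  \sum_(p : I * J * H) a p.1.1 * b p.1.2 * c p.2 =
  (\sum_i a i) * (\sum_j b j) * \sum_h c h.
Proof. by rewrite big_distrlr /= pair_bigA big_distrlr pair_bigA. Qed.

Lemma haar_quadrature (F : numFieldType) (N : nat) :
  exists (T : finType) (w : T -> F) (g : T -> 'M[F]_2),
    (forall a, \det (g a) = 1) /\ haar_exact w g N.
Proof.
have [mu muE] := torus_weights F N.
have [nu nuE] := interval_weights F (2 * N).+1.
pose T := ('I_(4 * N).+1 * 'I_(4 * N).+1 * 'I_(2 * N).+1)%type.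
pose w (p : T) : F := mu p.1.1 * mu p.1.2 * nu p.2.
pose g (p : T) : 'M[F]_2 := sl2_point p.1.1.+1%:R p.1.2.+1%:R p.2.+1%:R.
exists T, w, g; split=> [a|i j k l leN] /=.
  by rewrite det_sl2_point ?pnatr_eq0.
(* At a [sl2_point] a monomial splits into a character of each torus and a function of x. The torus
   averages force i + j = k + l and i + k = j + l, that is, i = l and j = k. *)
transitivity
  ((\sum_t mu t * (t.+1%:R ^+ (i + j) * t.+1%:R^-1 ^+ (k + l))) *
   (\sum_u mu u * (u.+1%:R ^+ (i + k) * u.+1%:R^-1 ^+ (j + l))) *
   \sum_x nu x * (x.+1%:R ^+ i * (x.+1%:R - 1) ^+ j)).
  rewrite -sum_prod3; apply: eq_bigr => -[[t u] x] _; rewrite /w /g /= !mxE /=.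
  by rewrite !(invfM, exprMn, exprD); ring.
rewrite !muE ?nuE; [|lia..].
rewrite /haar_moment -natrM mulnb; congr ((nat_of_bool _)%:R * _); lia.
Qed.

Lemma haar_value_recl (F : numFieldType) (i j : nat) :
  (i + j).+2%:R * haar_value F i.+1 j = i.+1%:R * haar_value F i j.
Proof.
rewrite /haar_value addSn !factS !natrM.
have f0 : (i + j)`!%:R != 0 :> F by rewrite pnatr_eq0 -lt0n fact_gt0.
have f1 : (i + j).+1%:R != 0 :> F by rewrite pnatr_eq0.
have f2 : (i + j).+2%:R != 0 :> F by rewrite pnatr_eq0.
rewrite -!natr1 in f1 f2 *.
by rewrite natrD in f1 f2 *; field; rewrite f0 f1 f2.
Qed.

Lemma haar_value_recr (F : numFieldType) (i j : nat) :
  (i + j).+2%:R * haar_value F i j.+1 = - (j.+1%:R * haar_value F i j).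
Proof.
rewrite /haar_value addnS !factS exprS !natrM.
have f0 : (i + j)`!%:R != 0 :> F by rewrite pnatr_eq0 -lt0n fact_gt0.
have f1 : (i + j).+1%:R != 0 :> F by rewrite pnatr_eq0.
have f2 : (i + j).+2%:R != 0 :> F by rewrite pnatr_eq0.
rewrite -!natr1 in f1 f2 *.
by rewrite natrD in f1 f2 *; field; rewrite f0 f1 f2.
Qed.

(** On the support, for instance l = i + 1 and j = k in the first identity, the factor i + j + k + l
    + 3 is 2 (i + j + 2), and a recurrence of beta values remains. Written with the total degree,
    the factor is common to all monomials of a homogeneous polynomial. A truncated predecessor of 0
    comes with the factor 0. *)
Lemma haar_moment_rec (F : numFieldType) (i j k l : nat) :
  [/\ (i + j + k + l + 3)%:R * haar_moment F i.+1 j k l =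
        2 * (l%:R * haar_moment F i j k l.-1),
      (i + j + k + l + 3)%:R * haar_moment F i j.+1 k l =
        - (2 * (k%:R * haar_moment F i j k.-1 l)),
      (i + j + k + l + 3)%:R * haar_moment F i j k.+1 l =
        - (2 * (j%:R * haar_moment F i j.-1 k l)) &
      (i + j + k + l + 3)%:R * haar_moment F i j k l.+1 =
        2 * (i%:R * haar_moment F i.-1 j k l)].
Proof.
have twice p q (d : nat) : (d = (p + q).+2 * 2)%N ->
    d%:R = 2 * (p + q).+2%:R :> F by move=> ->; rewrite natrM mulrC.
rewrite /haar_moment; split.
- case: l => [|l]; rewrite ?mul0r ?mulr0 // eqSS.
  have [-> /=|_] := eqVneq i l; last by rewrite !mul0r !mulr0.
  have [-> /=|_] := eqVneq j k; last by rewrite !mul0r !mulr0.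
  rewrite (twice l k); last lia.
  by rewrite !mul1r -mulrA haar_value_recl.
- case: k => [|k]; rewrite ?andbF ?mul0r ?mulr0 ?oppr0 // eqSS.
  have [-> /=|_] := eqVneq i l; last by rewrite !mul0r !mulr0 oppr0.
  have [-> /=|_] := eqVneq j k; last by rewrite !mul0r !mulr0 oppr0.
  rewrite (twice l k); last lia.
  by rewrite !mul1r -mulrA haar_value_recr mulrN.
- case: j => [|j]; rewrite ?andbF ?mul0r ?mulr0 ?oppr0 // eqSS.
  have [-> /=|_] := eqVneq i l; last by rewrite !mul0r !mulr0 oppr0.
  have [-> /=|_] := eqVneq j k; last by rewrite !mul0r !mulr0 oppr0.
  rewrite (twice l k); last lia.
  by rewrite !mul1r -mulrA haar_value_recr mulrN.
- case: i => [|i]; rewrite ?mul0r ?mulr0 // eqSS.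
  have [-> /=|_] := eqVneq i l; last by rewrite !mul0r !mulr0.
  have [-> /=|_] := eqVneq j k; last by rewrite !mul0r !mulr0.
  rewrite (twice l k); last lia.
  by rewrite !mul1r -mulrA haar_value_recl.
Qed.

(** * Quadrature averages of polynomials in the entries of a group element *)

Definition gvar (i j : 'I_2) : 'I_(2 * 2) := mxvec_index i j.

Lemma big_gvar (V : Type) (idx : V) (op : Monoid.com_law idx)
    (f : 'I_(2 * 2) -> V) :
  \big[op/idx]_v f v =
  op (op (op (f (gvar 0 0)) (f (gvar 0 1))) (f (gvar 1 0))) (f (gvar 1 1)).
Proof.
rewrite (reindex _ (curry_mxvec_bij 2 2)) /=.
transitivity (\big[op/idx]_p f (gvar p.1 p.2)); first by apply: eq_bigr => -[].
rewrite -(pair_bigA _ (fun i j => f (gvar i j))) /=.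
rewrite !big_ord_recl !big_ord0 !Monoid.mulm1.
have -> : lift ord0 ord0 = 1 :> 'I_2 by apply: val_inj.
by rewrite !Monoid.mulmA.
Qed.

Lemma gvar_inj (i j k l : 'I_2) : (gvar i j == gvar k l) = ((i == k) && (j == l)).
Proof.
apply/eqP/andP => [|[/eqP-> /eqP->]//].
by move=> /cast_ord_inj/enum_rank_inj[-> ->].
Qed.

(** Only the entries of the group element are variables; the generic matrices will live in the
    coefficient ring [K], which the average treats as scalars. *)
Definition quad_avg (F : numFieldType) (K : comNzRingType)
    (iota : {rmorphism F -> K}) (T : finType) (w : T -> F) (g : T -> 'M[F]_2)
    (P : {mpoly K[2 * 2]}) : K :=
  \sum_a iota (w a) * P.@[fun v => iota (mxvec (g a) 0 v)].

Lemma quad_avg_is_scalar (F : numFieldType) (K : comNzRingType)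
    (iota : {rmorphism F -> K}) (T : finType) (w : T -> F) (g : T -> 'M[F]_2) :
  scalar (quad_avg iota w g).
Proof.
move=> c P Q; rewrite /quad_avg mulr_sumr -big_split /=.
by apply: eq_bigr => a _; rewrite mevalD mevalZ mulrDr mulrCA.
Qed.

HB.instance Definition _ (F : numFieldType) (K : comNzRingType)
    (iota : {rmorphism F -> K}) (T : finType) (w : T -> F) (g : T -> 'M[F]_2) :=
  GRing.isLinear.Build K {mpoly K[2 * 2]} K *%R (quad_avg iota w g)
    (quad_avg_is_scalar iota w g).

Lemma quad_avgZ (F : numFieldType) (K : comNzRingType)
    (iota : {rmorphism F -> K}) (T : finType) (w : T -> F) (g : T -> 'M[F]_2)
    (c : K) (P : {mpoly K[2 * 2]}) :
  quad_avg iota w g (c *: P) = c * quad_avg iota w g P.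
Proof. exact: linearZ. Qed.

Lemma quad_avgX (F : numFieldType) (K : comNzRingType)
    (iota : {rmorphism F -> K}) (T : finType) (w : T -> F) (g : T -> 'M[F]_2)
    (N : nat) (m : 'X_{1..2 * 2}) :
  haar_exact w g N -> (mdeg m <= 2 * N)%N ->
  quad_avg iota w g 'X_[m] = iota (haar_moment F (m (gvar 0 0)) (m (gvar 0 1))
    (m (gvar 1 0)) (m (gvar 1 1))).
Proof.
rewrite mdegE big_gvar => wgN /wgN <-; rewrite rmorph_sum.
apply: eq_bigr => a _; rewrite mevalX big_gvar !mxvecE.
by rewrite /= !rmorphM !rmorphXn.
Qed.

(* Multiplying by an entry of [g] amounts, up to a scalar depending on the degree, to
   differentiating with respect to the complementary entry. *)
Lemma quad_avg_mulX (F : numFieldType) (K : comNzRingType)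
    (iota : {rmorphism F -> K}) (T : finType) (w : T -> F) (g : T -> 'M[F]_2)
    (N d : nat) (P : {mpoly K[2 * 2]}) (i j : 'I_2) :
  haar_exact w g N -> (d < 2 * N)%N -> P \is d.-homog ->
  iota (d + 3)%:R * quad_avg iota w g ('X_(gvar i j) * P) =
  iota (2 * (-1) ^+ (i + j)) *
    quad_avg iota w g P^`M(gvar (rev_ord i) (rev_ord j)).
Proof.
move=> wgN ltdN /dhomogP homP.
have -> : 'X_(gvar i j) * P =
    \sum_(m <- msupp P) P@_m *: ('X_(gvar i j) * 'X_[m]).
  by rewrite [in LHS](mpolyE P) mulr_sumr; under eq_bigr do rewrite -scalerAr.
have -> : P^`M(gvar (rev_ord i) (rev_ord j)) =
    \sum_(m <- msupp P) P@_m *: 'X_[m]^`M(gvar (rev_ord i) (rev_ord j)).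
  rewrite [in LHS](mpolyE P) (linear_sum (mderiv _)).
  by apply: eq_bigr => m _; exact: mderivZ.
rewrite !(linear_sum (quad_avg iota w g)).
rewrite [LHS]big_distrr [RHS]big_distrr /=.
rewrite !big_seq; apply: eq_bigr => m /homP /= mdegm; have {}mdegm : mdeg m = d by [].
rewrite !quad_avgZ /= mulrCA [RHS]mulrCA; congr (_ * _).
rewrite mderivX -mpolyXD quad_avgZ /=.
rewrite !(quad_avgX iota wgN); last 2 first.
- by rewrite (leq_trans (mdegB _ _)) // mdegm ltnW.
- by rewrite mdegD mdeg1 mdegm.
rewrite -(rmorph_nat iota) -!rmorphM; congr (iota _).
rewrite !mnmDE !mnmBE !mnm1E !gvar_inj -mdegm mdegE big_gvar.
have [e1 e2 e3 e4] := haar_moment_rec F (m (gvar 0 0)) (m (gvar 0 1))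
    (m (gvar 1 0)) (m (gvar 1 1)).
(* The diagonal entries are complementary to each other, and so are the off-diagonal ones, with sign
   -1: one recurrence for each entry. *)
have [-> | ->] := ord2P i; have [-> | ->] := ord2P j;
  rewrite !rev_ord2 /= !subn0 !add0n add1n subn1.
- by rewrite e1; ring.
- by rewrite e2; ring.
- by rewrite e3; ring.
- by rewrite e4; ring.
Qed.

(** * Contraction of products of bilinear forms *)

(* With [G] the generic matrix [(X_(gvar i j))], [lform B i j = (B G^T)_(i, j)] and
   [qform B i j = (G B G^T)_(i, j)]. *)
Definition lform (K : comNzRingType) (B : 'M[K]_2) (i j : 'I_2) : {mpoly K[2 * 2]} :=
  B i 0 *: 'X_(gvar j 0) + B i 1 *: 'X_(gvar j 1).

Definition qform (K : comNzRingType) (B : 'M[K]_2) (i j : 'I_2) : {mpoly K[2 * 2]} :=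
  'X_(gvar i 0) * lform B 0 j + 'X_(gvar i 1) * lform B 1 j.

Lemma mderiv_lform (K : comNzRingType) (B : 'M[K]_2) (i j k l : 'I_2) :
  (lform B i j)^`M(gvar k l) = ((j == k)%:R * B i l)%:MP.
Proof.
rewrite /lform mderivD !mderivZ !mderivX !mnm1E !gvar_inj.
have e a b c d : ((a == b) && (c == d))%:R *: 'X_[U_(gvar a c) - U_(gvar b d)] =
    ((a == b) && (c == d))%:R%:MP :> {mpoly K[2 * 2]}.
  case: eqP => [->|_]; last by rewrite scale0r mpolyC0.
  case: eqP => [->|_]; last by rewrite scale0r mpolyC0.
  by rewrite scale1r -[X in (X - _)%MM]add0m addmK mpolyX0.
rewrite !e -!mul_mpolyC -!mpolyCM -mpolyCD; congr (_%:MP).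
by have [-> | ->] := ord2P l; case: (j == k); rewrite /=; ring.
Qed.

Lemma mderiv_qform (K : comNzRingType) (B : 'M[K]_2) (i j k l : 'I_2) :
  (qform B i j)^`M(gvar k l) =
  (i == k)%:R * lform B l j + (j == k)%:R * lform B^T l i.
Proof.
(* A variable is itself a linear form, so [mderiv_lform] differentiates it too. *)
have X a b : 'X_(gvar a b) = lform (delta_mx 0 b) 0 a :> {mpoly K[2 * 2]}.
  rewrite /lform !mxE; have [-> | ->] := ord2P b; rewrite /=.
    by rewrite scale1r scale0r addr0.
  by rewrite scale1r scale0r add0r.
rewrite /qform mderivD !mderivM !mderiv_lform {1 2}X {1 2}(X _ 1) !mderiv_lform.
rewrite /lform !mxE -!mul_mpolyC.
have [-> | ->] := ord2P l; case: (i == k); case: (j == k) => /=;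
  rewrite ?mul1r ?mul0r ?mpolyC0 ?mpolyC1; ring.
Qed.

(* [sum_(a, c) (G B^T)_(j, a) eps_(a, c) d/dG_(k, c)] applied to [(G D G^T)_(l, m)]. *)
Lemma polarize_qform (K : comNzRingType) (B D : 'M[K]_2) (j k l m : 'I_2) :
  lform B 0 j * (qform D l m)^`M(gvar k 1) -
  lform B 1 j * (qform D l m)^`M(gvar k 0) =
  (l == k)%:R * qform (B^T *m eps_mx K *m D) j m +
  (m == k)%:R * qform (B^T *m eps_mx K *m D^T) j l.
Proof.
rewrite !mderiv_qform /qform /lform !(mxE, big_ord2) /= -!mul_mpolyC.
rewrite !(mpolyCD, mpolyCM, mpolyCB).
rewrite ?(subrr, subr0, sub0r, mpolyCN, mpolyC0, mpolyC1).
case: (l == k); case: (m == k) => /=; ring.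
Qed.

Lemma lform_homog (K : comNzRingType) (B : 'M[K]_2) (i j : 'I_2) :
  lform B i j \is 1.-homog.
Proof. by rewrite rpredD // rpredZ // dhomogX /= mdeg1. Qed.

Lemma qform_homog (K : comNzRingType) (B : 'M[K]_2) (i j : 'I_2) :
  qform B i j \is 2.-homog.
Proof.
by rewrite rpredD //; apply: (@dhomogM _ _ _ 1 _ 1);
  rewrite ?lform_homog // dhomogX /= mdeg1.
Qed.

Definition qprod (K : comNzRingType) (s : seq ('M[K]_2 * 'I_2 * 'I_2)) :
    {mpoly K[2 * 2]} :=
  \prod_(t <- s) qform t.1.1 t.1.2 t.2.

Lemma qprod_homog (K : comNzRingType) (s : seq ('M[K]_2 * 'I_2 * 'I_2)) :
  qprod s \is (2 * size s).-homog.
Proof.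
rewrite /qprod; elim: s => [|t s IHs] /=; first by rewrite big_nil dhomog1.
have -> : (2 * (size s).+1 = 2 + 2 * size s)%N by rewrite mulnS.
by rewrite big_cons; apply: dhomogM => //; apply: qform_homog.
Qed.

(* One step of the Wick-type expansion: the first leg of the head factor [B] is
   contracted with its second leg or with a leg of one of the other factors. *)
Lemma quad_avg_contract (F : numFieldType) (K : comNzRingType)
    (iota : {rmorphism F -> K}) (T : finType) (w : T -> F) (g : T -> 'M[F]_2)
    (N : nat) (MM WW : 'M[K]_2 -> Prop) (J : K -> Prop) :
  haar_exact w g N ->
  (forall x y, J x -> J y -> J (x + y)) -> J 0 ->
  (forall c x, J x -> J (iota c * x)) ->
  (forall B D, MM B -> WW D -> MM (B^T *m eps_mx K *m D)) ->
  (forall B D, MM B -> WW D -> MM (B^T *m eps_mx K *m D^T)) ->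
  forall n, (n <= N)%N ->
  (forall B (s : seq ('M[K]_2 * 'I_2 * 'I_2)), MM B ->
    (forall t, t \in s -> WW t.1.1) -> (size s < n)%N ->
    J ((B 0 1 - B 1 0) * quad_avg iota w g (qprod s))) ->
  forall (s : seq ('M[K]_2 * 'I_2 * 'I_2)) B i j, MM B ->
    (forall t, t \in s -> WW t.1.1) -> (size s < n)%N ->
    J (quad_avg iota w g (qform B i j * qprod s)).
Proof.
move=> wgN JD J0 JZ MW MWT n lenN Jtr s.
have [m] := ubnP (size s); elim: m s => // m IHm s /ltnSE lesm B i j MB Ws ltsn.
have Jb (b : bool) P : J (quad_avg iota w g P) ->
    J (quad_avg iota w g (b%:R * P)).
  by case: b => JP; rewrite ?mul1r // mul0r raddf0.
(* By [quad_avg_mulX], multiplying by an entry of row [i] becomes differentiating along the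
   complementary row [k]. The derivation [dd] is what this does to the factors other than the
   head. *)
pose k := rev_ord i; pose dd P := lform B 0 j * P^`M(gvar k 1) -
  lform B 1 j * P^`M(gvar k 0).
(* Leibniz rule along [s2], with the factors already passed stored in [s1]. Each term merges the
   head with one factor, leaving fewer factors beside the new head, so [IHm] applies. *)
have Jdd (s2 : seq ('M[K]_2 * 'I_2 * 'I_2)) :
    forall s1 : seq ('M[K]_2 * 'I_2 * 'I_2), (forall t, t \in s1 -> WW t.1.1) ->
    (forall t, t \in s2 -> WW t.1.1) -> (size s1 + size s2 <= size s)%N ->
    J (quad_avg iota w g (dd (qprod s2) * qprod s1)).
  elim: s2 => [|t s2 IH2] s1 W1 W2 les.
    by rewrite /dd /qprod big_nil !mderivC !mulr0 subrr mul0r raddf0.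
  have Wt : WW t.1.1 by apply: W2; rewrite mem_head.
  have W2' t' : t' \in s2 -> WW t'.1.1.
    by move=> t's; apply: W2; rewrite in_cons t's orbT.
  have -> : dd (qprod (t :: s2)) * qprod s1 =
      dd (qform t.1.1 t.1.2 t.2) * qprod (s2 ++ s1) +
      dd (qprod s2) * qprod (t :: s1).
    by rewrite /dd /qprod !big_cons big_cat /= !mderivM; ring.
  rewrite raddfD /=; apply: (JD); last first.
    apply: IH2 => //; last by rewrite /= addSnnS.
    by move=> t'; rewrite in_cons => /predU1P[->|/W1].
  have W12 t' : t' \in s2 ++ s1 -> WW t'.1.1.
    by rewrite mem_cat => /orP[/W2'|/W1].
  rewrite /= in les.
  have les12 : (size (s2 ++ s1) < size s)%N by rewrite size_cat addnC -addnS.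
  rewrite /dd polarize_qform mulrDl raddfD /= -!mulrA.
  by apply: (JD); apply: (Jb); apply: (IHm) => //;
    solve [exact: MW | exact: MWT | exact: leq_trans les12 _ | exact: (ltn_trans les12)].
set A := quad_avg _ _ _ _.
have homP a : lform B a j * qprod s \is (2 * size s).+1.-homog.
  exact: (dhomogM (lform_homog B a j) (qprod_homog s)).
have ltd : ((2 * size s).+1 < 2 * N)%N by lia.
(* The first summand is the contraction of the head with itself, governed by [Jtr]; [dd] collects
   its contractions with the other factors. *)
have AE : iota ((2 * size s).+1 + 3)%:R * A = iota (2 * (-1) ^+ i) *
    (((j == k)%:R * (B 0 1 - B 1 0)) * quad_avg iota w g (qprod s) +
     quad_avg iota w g (dd (qprod s))).
  rewrite /A /qform mulrDl -!mulrA raddfD /= mulrDr.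
  rewrite !(quad_avg_mulX iota i _ wgN ltd (homP _)) !exprD !rev_ord2.
  rewrite !mderivM !mderiv_lform !mul_mpolyC !(raddfD (quad_avg iota w g)) /=.
  rewrite (raddfN (quad_avg iota w g)) !quad_avgZ expr0 expr1.
  by rewrite !(rmorphM, rmorphN1, rmorph1); ring.
have u0 : ((2 * size s).+1 + 3)%:R != 0 :> F by rewrite pnatr_eq0 addn3.
have -> : A = iota ((2 * size s).+1 + 3)%:R^-1 *
    (iota ((2 * size s).+1 + 3)%:R * A).
  by rewrite mulrA -rmorphM mulVf // rmorph1 mul1r.
rewrite AE; apply/JZ/JZ; apply: JD; last first.
  have := Jdd s [::]; rewrite [X in _ * X]big_nil mulr1; exact.
rewrite -mulrA; case: (j == k); last by rewrite mul0r.
by rewrite mul1r; apply: Jtr.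
Qed.

(** By [adj_mx22] the adjugate of [g] is [g^T] between two copies of the form, up to sign; the outer
    copy swaps the columns, and all signs combine into [(-1) ^+ j]. *)
Lemma conj_entry (K : comNzRingType) (g A : 'M[K]_2) (i j : 'I_2) :
  (g *m A *m \adj g) i j =
  (g *m ((-1) ^+ j *: (A *m eps_mx K)) *m g^T) i (rev_ord j).
Proof.
rewrite adj_mx22; have [-> | ->] := ord2P j;
  by rewrite !rev_ord2 !(mxE, big_ord2) /=; ring.
Qed.

Lemma qform_eval (K : comNzRingType) (B g : 'M[K]_2) (i j : 'I_2) :
  (qform B i j).@[fun v => mxvec g 0 v] = (g *m B *m g^T) i j.
Proof.
rewrite /qform /lform !(mevalD, mevalM, mevalZ, mevalXU) !mxvecE.
by rewrite !(mxE, big_ord2) /=; ring.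
Qed.

Definition conj_avg (F : numFieldType) (K : comNzRingType)
    (iota : {rmorphism F -> K}) (T : finType) (w : T -> F) (g : T -> 'M[F]_2)
    (s : seq ('M[K]_2 * 'I_2 * 'I_2)) : K :=
  \sum_a iota (w a) * \prod_(t <- s)
    (map_mx iota (g a) *m t.1.1 *m \adj (map_mx iota (g a))) t.1.2 t.2.

(* Turns the entry [(G A G^-1)_(i, j)] into one of [G (A eps) G^T]. *)
Definition twist (K : comNzRingType) (t : 'M[K]_2 * 'I_2 * 'I_2) :
    'M[K]_2 * 'I_2 * 'I_2 :=
  ((-1) ^+ t.2 *: (t.1.1 *m eps_mx K), t.1.2, rev_ord t.2).

Lemma conj_avg_quad (F : numFieldType) (K : comNzRingType)
    (iota : {rmorphism F -> K}) (T : finType) (w : T -> F) (g : T -> 'M[F]_2)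
    (s : seq ('M[K]_2 * 'I_2 * 'I_2)) :
  conj_avg iota w g s = quad_avg iota w g (qprod [seq twist t | t <- s]).
Proof.
apply: eq_bigr => a _; congr (_ * _).
rewrite /qprod big_map (big_morph _ (mevalM _) (meval1 _)).
apply: eq_bigr => t _; rewrite conj_entry -qform_eval.
by apply: meval_eq => v; rewrite -map_mxvec mxE.
Qed.

(** The sign is an arbitrary power of -1 because twisting and contraction both produce signs. *)
Definition twisted (K : comNzRingType) (WW : 'M[K]_2 -> Prop) (B : 'M[K]_2) :=
  exists2 A, WW A & exists n : nat, B = (-1) ^+ n *: (A *m eps_mx K).

(** Since [eps^T A^T eps] is [\adj A], contracting two legs multiplies the underlying matrices, one
    of them adjugated. *)
Lemma twisted_mul (K : comNzRingType) (MM WW : 'M[K]_2 -> Prop) (B D : 'M[K]_2) :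
  (forall A D, MM A -> WW D -> MM (\adj A *m D)) ->
  twisted MM B -> twisted WW D -> twisted MM (B^T *m eps_mx K *m D).
Proof.
move=> MWM [A MA [n ->]] [C WC [m ->]]; exists (\adj A *m C); first exact: MWM.
exists (n + m)%N; rewrite adj_mx22 exprD; move: (_ ^+ n) (_ ^+ m) => x y.
by apply: matrix22P; rewrite !(mxE, big_ord2) /=; ring.
Qed.

Lemma twisted_mulT (K : comNzRingType) (MM WW : 'M[K]_2 -> Prop) (B D : 'M[K]_2) :
  (forall A D, MM A -> WW D -> MM (\adj A *m \adj D)) ->
  twisted MM B -> twisted WW D -> twisted MM (B^T *m eps_mx K *m D^T).
Proof.
move=> MWM [A MA [n ->]] [C WC [m ->]].
exists (\adj A *m \adj C); first exact: MWM.
(* The extra sign comes from [eps_mx] squaring to -1. *)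
exists (n + m).+1; rewrite !adj_mx22 exprS exprD.
move: (_ ^+ n) (_ ^+ m) => x y.
by apply: matrix22P; rewrite !(mxE, big_ord2) /=; ring.
Qed.

Lemma twisted_trace (K : comNzRingType) (A : 'M[K]_2) (n : nat) (x : K) :
  let B := (-1) ^+ n *: (A *m eps_mx K) in
  (B 0 1 - B 1 0) * x = (-1) ^+ n * (\tr A * x).
Proof. by rewrite /= trace_mx22 !(mxE, big_ord2) /=; ring. Qed.

Lemma twist_mem (K : comNzRingType) (WW : 'M[K]_2 -> Prop)
    (s : seq ('M[K]_2 * 'I_2 * 'I_2)) :
  (forall t, t \in s -> WW t.1.1) ->
  forall t, t \in [seq twist t | t <- s] -> twisted WW t.1.1.
Proof.
by move=> Ws t /mapP[u /Ws Wu ->]; exists u.1.1 => //; exists u.2.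
Qed.

(** Contracting the head until it closes on itself splits off the trace of a matrix in [WW] and
    leaves a shorter product, so the average is built from such traces and constants. *)
Lemma quad_avg_words (F : numFieldType) (K : comNzRingType)
    (iota : {rmorphism F -> K}) (T : finType) (w : T -> F) (g : T -> 'M[F]_2)
    (N : nat) (WW : 'M[K]_2 -> Prop) (R0 : K -> Prop) :
  haar_exact w g N ->
  (forall x y, R0 x -> R0 y -> R0 (x + y)) ->
  (forall x y, R0 x -> R0 y -> R0 (x * y)) ->
  (forall c, R0 (iota c)) ->
  (forall A B, WW A -> WW B -> WW (A *m B)) ->
  (forall A, WW A -> WW (\adj A)) ->
  (forall A, WW A -> R0 (\tr A)) ->
  forall s : seq ('M[K]_2 * 'I_2 * 'I_2),
    (forall t, t \in s -> twisted WW t.1.1) -> (size s <= N)%N ->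
    R0 (quad_avg iota w g (qprod s)).
Proof.
move=> wgN RD RM RC WM Wa Wt s.
have [m] := ubnP (size s); elim: m s => // m IHm [|t s] /ltnSE lesm Ws lesN.
  rewrite /qprod big_nil -mpolyX0 (quad_avgX iota wgN) ?mdeg0 //.
have Wt1 : twisted WW t.1.1 by apply: Ws; rewrite mem_head.
rewrite /qprod big_cons.
apply: (quad_avg_contract (J := R0) (MM := twisted WW) (WW := twisted WW) wgN _ _ _ _ _ lesN) => //.
- by have := RC 0; rewrite rmorph0.
- by move=> c x Rx; apply: RM.
- by move=> B D; apply: twisted_mul => A C WA WC; apply/WM/WC/Wa.
- by move=> B D; apply: twisted_mulT => A C WA WC; apply/WM/Wa/WC/Wa.
- move=> B s' [A WA [n ->]] Ws' les'; rewrite twisted_trace.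
  apply: (RM); first by have := RC ((-1) ^+ n); rewrite rmorphXn rmorphN1.
  apply: RM; first exact: Wt.
  by apply: IHm => //; rewrite ?(leq_trans les') // (leq_trans _ lesN) // ltnW.
- by move=> t' t's; apply: Ws; rewrite in_cons t's orbT.
Qed.

Lemma conj_avg_words (F : numFieldType) (K : comNzRingType)
    (iota : {rmorphism F -> K}) (T : finType) (w : T -> F) (g : T -> 'M[F]_2)
    (N : nat) (WW : 'M[K]_2 -> Prop) (R0 : K -> Prop) :
  haar_exact w g N ->
  (forall x y, R0 x -> R0 y -> R0 (x + y)) ->
  (forall x y, R0 x -> R0 y -> R0 (x * y)) ->
  (forall c, R0 (iota c)) ->
  (forall A B, WW A -> WW B -> WW (A *m B)) ->
  (forall A, WW A -> WW (\adj A)) ->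
  (forall A, WW A -> R0 (\tr A)) ->
  forall s : seq ('M[K]_2 * 'I_2 * 'I_2),
    (forall t, t \in s -> WW t.1.1) -> (size s <= N)%N ->
    R0 (conj_avg iota w g s).
Proof.
move=> wgN RD RM RC WM Wa Wt s Ws lesN; rewrite conj_avg_quad.
apply: (quad_avg_words wgN RD RM RC WM Wa Wt); last by rewrite size_map.
exact: twist_mem.
Qed.

(** The chain of contractions starting at the distinguished head stays in [MM] and closes to a trace
    in [J]. The factors left over average into [R0], so every term is an [R0]-multiple of one such
    trace. *)
Lemma conj_avg_head (F : numFieldType) (K : comNzRingType)
    (iota : {rmorphism F -> K}) (T : finType) (w : T -> F) (g : T -> 'M[F]_2)
    (N : nat) (MM WW : 'M[K]_2 -> Prop) (R0 J : K -> Prop) :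
  haar_exact w g N ->
  (forall x y, R0 x -> R0 y -> R0 (x + y)) ->
  (forall x y, R0 x -> R0 y -> R0 (x * y)) ->
  (forall c, R0 (iota c)) ->
  (forall A B, WW A -> WW B -> WW (A *m B)) ->
  (forall A, WW A -> WW (\adj A)) ->
  (forall A, WW A -> R0 (\tr A)) ->
  (forall x y, J x -> J y -> J (x + y)) -> J 0 ->
  (forall x y, R0 x -> J y -> J (x * y)) ->
  (forall A B, MM A -> WW B -> MM (\adj A *m B)) ->
  (forall A, MM A -> J (\tr A)) ->
  forall (s : seq ('M[K]_2 * 'I_2 * 'I_2)) A i j,
    MM A -> (forall t, t \in s -> WW t.1.1) -> (size s < N)%N ->
    J (conj_avg iota w g ((A, i, j) :: s)).
Proof.
move=> wgN RD RM RC WM Wa Wt JD J0 JM MWM Mt s A i j MA Ws lesN.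
rewrite conj_avg_quad /qprod /= big_cons.
apply: (quad_avg_contract (J := J) (MM := twisted MM) (WW := twisted WW)
  wgN _ _ _ _ _ (leqnn N)) => //.
- by move=> c x Jx; apply: JM.
- by move=> B D; apply: twisted_mul.
- by move=> B D; apply: twisted_mulT => C C' MC WC; apply/MWM/Wa/WC.
- move=> B s' [C MC [n ->]] Ws' les'; rewrite twisted_trace.
  apply: (JM); first by have := RC ((-1) ^+ n); rewrite rmorphXn rmorphN1.
  rewrite mulrC; apply: JM; last exact: Mt.
  by apply: (quad_avg_words wgN RD RM RC WM Wa Wt) => //; apply: ltnW.
- by exists A => //; exists j.
- exact: twist_mem.
- by rewrite size_map.
Qed.

(** * The action on generic matrices and the Reynolds operator *)

Definition CCnum : numFieldType := complex Rdefinitions.R.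

Definition embC (n : nat) : {rmorphism CCnum -> Pol n} :=
  @mpolyC (n * (2 * 2)) CC.

Definition emb (n : nat) (g : 'M[CC]_2) : 'M[Pol n]_2 := map_mx (embC n) g.

HB.instance Definition _ (n : nat) (g : 'M[CC]_2) :=
  GRing.RMorphism.copy (@act n g) (comp_mpoly (@act_tuple n g)).

Lemma actZ (n : nat) (g : 'M[CC]_2) (c : CC) (f : Pol n) :
  act g (c *: f) = c *: act g f.
Proof. exact: comp_mpolyZ. Qed.

Lemma actC (n : nat) (g : 'M[CC]_2) (c : CC) : act g (embC n c) = embC n c.
Proof. exact: comp_mpolyC. Qed.

Lemma act_Xg (n : nat) (g : 'M[CC]_2) (k : 'I_n) :
  map_mx (act g) (Xg k) = emb n g *m Xg k *m \adj (emb n g).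
Proof.
apply/matrixP => i j; rewrite [LHS]mxE [Xg k i j]mxE /act comp_mpolyXU -tnth_nth tnth_mktuple.
by rewrite mxvecE mxE mxvecE /conj_mx /emb map_mx_adj.
Qed.

Lemma mul_emb_adj (n : nat) (g : 'M[CC]_2) : \det g = 1 ->
  emb n g *m \adj (emb n g) = 1%:M /\ \adj (emb n g) *m emb n g = 1%:M.
Proof.
by move=> g1; rewrite mul_mx_adj mul_adj_mx /emb det_map_mx g1 rmorph1.
Qed.

(** * Ideals and invariants of the polynomial ring *)

Definition glue_ord (V : Type) (m1 m2 : nat) (u : 'I_m1 -> V) (v : 'I_m2 -> V)
    (i : 'I_(m1 + m2)) : V :=
  match split i with inl j => u j | inr j => v j end.

Lemma sum_glue_ord (K : pzSemiRingType) (m1 m2 : nat) (u1 v1 : 'I_m1 -> K)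
    (u2 v2 : 'I_m2 -> K) :
  \sum_(i < m1 + m2) glue_ord u1 u2 i * glue_ord v1 v2 i =
  \sum_(i < m1) u1 i * v1 i + \sum_(i < m2) u2 i * v2 i.
Proof.
rewrite big_split_ord /glue_ord; congr (_ + _); apply: eq_bigr => i _.
  by rewrite (unsplitK (inl i)).
by rewrite (unsplitK (inr i)).
Qed.

Lemma in_ideal0 (n : nat) (S : Pol n -> Prop) : in_ideal S 0.
Proof. by exists 0%N, (fun _ => 0), (fun _ => 0); split=> [[]|]; rewrite ?big_ord0. Qed.

Lemma in_idealMl (n : nat) (S : Pol n -> Prop) (a f : Pol n) :
  in_ideal S f -> in_ideal S (a * f).
Proof.
move=> [m [c [s [Ss ->]]]]; exists m, (fun i => a * c i), s; split=> //.
by rewrite mulr_sumr; apply: eq_bigr => i _; rewrite mulrA.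
Qed.

Lemma in_ideal_gen (n : nat) (S : Pol n -> Prop) (f : Pol n) :
  S f -> in_ideal S f.
Proof.
by move=> Sf; exists 1%N, (fun _ => 1), (fun _ => f); rewrite big_ord1 mul1r.
Qed.

Lemma in_idealD (n : nat) (S : Pol n -> Prop) (f h : Pol n) :
  in_ideal S f -> in_ideal S h -> in_ideal S (f + h).
Proof.
move=> [m1 [c1 [s1 [Ss1 ->]]]] [m2 [c2 [s2 [Ss2 ->]]]].
exists (m1 + m2)%N, (glue_ord c1 c2), (glue_ord s1 s2); split=> [i|].
  by rewrite /glue_ord; case: split.
by rewrite sum_glue_ord.
Qed.

Lemma in_idealN (n : nat) (S : Pol n -> Prop) (f : Pol n) :
  in_ideal S f -> in_ideal S (- f).
Proof. by rewrite -mulN1r; apply: in_idealMl. Qed.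

Lemma in_ideal_sum (n : nat) (S : Pol n -> Prop) (I : Type) (s : seq I)
    (f : I -> Pol n) :
  (forall i, in_ideal S (f i)) -> in_ideal S (\sum_(i <- s) f i).
Proof. by move=> Sf; elim/big_ind: _ => //; [exact: in_ideal0 | exact: in_idealD]. Qed.

Lemma in_ideal_le (n : nat) (S S' : Pol n -> Prop) (f : Pol n) :
  (forall x, S x -> S' x) -> in_ideal S f -> in_ideal S' f.
Proof. by move=> SS' [m [c [s [Ss ->]]]]; exists m, c, s; split=> // i; apply: SS'. Qed.

(* Invariance on the nose, before passing to the quotient. *)
Definition sl2_fixed (n : nat) (f : Pol n) : Prop :=
  forall g : 'M[CC]_2, \det g = 1 -> act g f = f.

Lemma sl2_fixedD (n : nat) (f h : Pol n) :
  sl2_fixed f -> sl2_fixed h -> sl2_fixed (f + h).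
Proof. by move=> Ff Fh g g1; rewrite rmorphD /= Ff // Fh. Qed.

Lemma sl2_fixedN (n : nat) (f : Pol n) : sl2_fixed f -> sl2_fixed (- f).
Proof. by move=> Ff g g1; rewrite rmorphN /= Ff. Qed.

Lemma sl2_fixedM (n : nat) (f h : Pol n) :
  sl2_fixed f -> sl2_fixed h -> sl2_fixed (f * h).
Proof. by move=> Ff Fh g g1; rewrite rmorphM /= Ff // Fh. Qed.

Lemma sl2_fixedC (n : nat) (c : CCnum) : sl2_fixed (embC n c).
Proof. by move=> g _; apply: actC. Qed.

Lemma sl2_fixed0 (n : nat) : sl2_fixed (0 : Pol n).
Proof. by move=> g _; apply: rmorph0. Qed.

Lemma sl2_fixed1 (n : nat) : sl2_fixed (1 : Pol n).
Proof. by move=> g _; apply: rmorph1. Qed.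

Lemma sl2_fixed_inv_mod (n : nat) (S : Pol n -> Prop) (f : Pol n) :
  sl2_fixed f -> inv_mod S f.
Proof. by move=> Ff g g1; rewrite Ff // subrr; apply: in_ideal0. Qed.

(** * Words in the generic matrices and their traces *)

Lemma eval_cons (n : nat) (a : 'I_n * bool) (u : word n) :
  eval_word (a :: u) = letter_mx a *m eval_word u.
Proof. by rewrite /eval_word /=. Qed.

Lemma eval_nil (n : nat) : eval_word [::] = 1%:M :> 'M[Pol n]_2.
Proof. by rewrite /eval_word /=. Qed.

Lemma eval_cat (n : nat) (u v : word n) :
  eval_word (u ++ v) = eval_word u *m eval_word v.
Proof.
elim: u => [|a u IHu]; first by rewrite eval_nil mul1mx.
by rewrite cat_cons !eval_cons {}IHu mulmxA.
Qed.

Definition word_inv (n : nat) (u : word n) : word n :=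
  rev [seq (a.1, ~~ a.2) | a <- u].

Lemma eval_word_inv (n : nat) (u : word n) :
  eval_word (word_inv u) = \adj (eval_word u).
Proof.
rewrite /word_inv; elim: u => [|a u IHu].
  by rewrite eval_nil -[RHS]mul1mx mul_mx_adj det1.
rewrite map_cons rev_cons -cats1 eval_cat !eval_cons eval_nil mulmx1 {}IHu adjM22; congr (_ *m _).
by rewrite /letter_mx; case: a => k [] /=; rewrite ?adjK22.
Qed.

Definition is_word (n : nat) (A : 'M[Pol n]_2) : Prop := exists u, A = eval_word u.

Lemma is_wordM (n : nat) (A B : 'M[Pol n]_2) :
  is_word A -> is_word B -> is_word (A *m B).
Proof. by move=> [u ->] [v ->]; exists (u ++ v); rewrite eval_cat. Qed.

Lemma is_word_adj (n : nat) (A : 'M[Pol n]_2) : is_word A -> is_word (\adj A).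
Proof. by move=> [u ->]; exists (word_inv u); rewrite eval_word_inv. Qed.

Lemma is_word_Xg (n : nat) (k : 'I_n) : is_word (Xg k).
Proof. by exists (gen k); rewrite eval_cons eval_nil mulmx1. Qed.

Lemma act_eval (n : nat) (g : 'M[CC]_2) (u : word n) : \det g = 1 ->
  map_mx (act g) (eval_word u) = emb n g *m eval_word u *m \adj (emb n g).
Proof.
move=> g1; have [gV Vg] := mul_emb_adj n g1.
elim: u => [|a u IHu]; first by rewrite eval_nil map_mx1 mulmx1 gV.
rewrite eval_cons.
rewrite (conjM_mx _ _ Vg) map_mxM {}IHu; congr (_ *m _).
case: a => k []; rewrite /letter_mx [_.2]/= [_.1]/=; last exact: act_Xg.
by rewrite map_mx_adj act_Xg !adjM22 adjK22 mulmxA.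
Qed.

Lemma trw_fixed (n : nat) (u : word n) : sl2_fixed (trw u).
Proof.
move=> g g1; have [_ Vg] := mul_emb_adj n g1.
by rewrite /trw -trace_map_mx act_eval // mxtrace_mulC mulmxA Vg mul1mx.
Qed.

Lemma is_word_trace (n : nat) (A : 'M[Pol n]_2) : is_word A -> sl2_fixed (\tr A).
Proof. by move=> [u ->]; apply: trw_fixed. Qed.

Lemma det_Xg_fixed (n : nat) (k : 'I_n) : sl2_fixed (\det (Xg k)).
Proof.
move=> g g1; rewrite -det_map_mx act_Xg !det_mulmx mulrAC -det_mulmx.
by have [-> _] := mul_emb_adj n g1; rewrite det1 mul1r.
Qed.

(** * The averaging operator *)

Definition reynolds (n : nat) (T : finType) (w : T -> CCnum)
    (g : T -> 'M[CCnum]_2) (f : Pol n) : Pol n :=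
  \sum_a embC n (w a) * act (g a) f.

(** As the weights sum to 1, the difference is a combination of the elements [act g f - f], each in
    the ideal by hypothesis. *)
Lemma reynolds_ideal (n : nat) (S : Pol n -> Prop) (T : finType)
    (w : T -> CCnum) (g : T -> 'M[CCnum]_2) (f : Pol n) :
  (forall a, \det (g a) = 1) -> \sum_a w a = 1 -> inv_mod S f ->
  in_ideal S (f - reynolds w g f).
Proof.
move=> g1 w1 Sf.
have -> : f - reynolds w g f = \sum_a embC n (w a) * - (act (g a) f - f).
  under eq_bigr do rewrite opprB mulrBr.
  by rewrite sumrB -mulr_suml -rmorph_sum w1 rmorph1 mul1r.
by apply: in_ideal_sum => a; apply/in_idealMl/in_idealN/Sf/g1.
Qed.

Lemma reynoldsMr (n : nat) (T : finType) (w : T -> CCnum)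
    (g : T -> 'M[CCnum]_2) (f h : Pol n) :
  (forall a, \det (g a) = 1) -> sl2_fixed h ->
  reynolds w g (f * h) = reynolds w g f * h.
Proof.
move=> g1 Fh; rewrite mulr_suml; apply: eq_bigr => a _.
by rewrite rmorphM /= Fh // mulrA.
Qed.

Lemma reynolds_sum (n : nat) (T : finType) (w : T -> CCnum)
    (g : T -> 'M[CCnum]_2) (I : Type) (s : seq I) (f : I -> Pol n) :
  reynolds w g (\sum_(i <- s) f i) = \sum_(i <- s) reynolds w g (f i).
Proof.
rewrite exchange_big; apply: eq_bigr => a _.
by rewrite rmorph_sum mulr_sumr.
Qed.

Lemma reynoldsZ (n : nat) (T : finType) (w : T -> CCnum)
    (g : T -> 'M[CCnum]_2) (c : CC) (f : Pol n) :
  reynolds w g (c *: f) = embC n c * reynolds w g f.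
Proof.
rewrite mulr_sumr; apply: eq_bigr => a _.
by rewrite actZ -mul_mpolyC mulrCA.
Qed.

(** The list [s] is the same for all [g], so averaging the translates of [f] gives a [conj_avg]. *)
Definition act_entries (n : nat) (f : Pol n) (d : nat) : Prop :=
  exists s : seq ('M[Pol n]_2 * 'I_2 * 'I_2),
    [/\ size s = d, forall t, t \in s -> is_word t.1.1 &
      forall g : 'M[CC]_2, act g f =
        \prod_(t <- s) (emb n g *m t.1.1 *m \adj (emb n g)) t.1.2 t.2].

Lemma act_entries1 (n : nat) : act_entries (1 : Pol n) 0.
Proof. by exists [::]; split=> // g; rewrite rmorph1 big_nil. Qed.

Lemma act_entriesM (n : nat) (f h : Pol n) (d k : nat) :
  act_entries f d -> act_entries h k -> act_entries (f * h) (d + k).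
Proof.
move=> [s [<- Ws fE]] [u [<- Wu hE]]; exists (s ++ u); split.
- by rewrite size_cat.
- by move=> t; rewrite mem_cat => /orP[/Ws|/Wu].
- by move=> g; rewrite rmorphM /= fE hE big_cat.
Qed.

Lemma act_entriesX (n : nat) (v : 'I_(n * (2 * 2))) :
  act_entries ('X_v : Pol n) 1.
Proof.
case/mxvec_indexP: v => k v; case/mxvec_indexP: v => i j.
exists [:: (Xg k, i, j)]; split=> //.
  by move=> t; rewrite inE => /eqP ->; apply: is_word_Xg.
by move=> g; rewrite big_seq1 -act_Xg mxE [Xg k i j]mxE.
Qed.

Lemma act_entries_monomial (n : nat) (m : 'X_{1..n * (2 * 2)}) :
  act_entries ('X_[m] : Pol n) (mdeg m).
Proof.
rewrite mpolyXE_id mdegE.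
elim/big_ind2: _ => [|f d h k|v _]; [exact: act_entries1 | exact: act_entriesM |].
elim: (m v) => [|e IHe]; first exact: act_entries1.
rewrite exprS; exact: (act_entriesM (act_entriesX v) IHe).
Qed.

(** Invariance is read off the contractions: each monomial averages to a polynomial in traces of
    words. *)
Lemma reynolds_fixed (n N : nat) (T : finType) (w : T -> CCnum)
    (g : T -> 'M[CCnum]_2) (f : Pol n) :
  haar_exact w g N -> (msize f <= N)%N -> sl2_fixed (reynolds w g f).
Proof.
move=> wgN lefN; rewrite [f]mpolyE reynolds_sum big_seq.
apply: (big_ind (@sl2_fixed n)) => [|? ?|m mf].
- exact: sl2_fixed0.
- exact: sl2_fixedD.
rewrite reynoldsZ; apply: sl2_fixedM; first exact: sl2_fixedC.
have [s [sz Ws sE]] := act_entries_monomial m.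
have -> : reynolds w g 'X_[m] = conj_avg (embC n) w g s.
  by apply: eq_bigr => a _; rewrite sE.
apply: (conj_avg_words wgN (@sl2_fixedD n) (@sl2_fixedM n) (@sl2_fixedC n)
  (@is_wordM n) (@is_word_adj n) (@is_word_trace n) Ws).
by rewrite sz (leq_trans _ lefN) // ltnW // msize_mdeg_lt.
Qed.

(** * The kernel *)

(** Polynomials represent classes in B(F_n), so invariance of the coefficients and the final
    equality are both taken modulo [relF]. *)
Definition in_kernel (n : nat) (L : Type) (r : L -> word n) (f : Pol n) : Prop :=
  exists (m : nat) (b t : 'I_m -> Pol n),
    (forall i, inv_mod (@relF n) (b i) /\ kernel_gen r (t i)) /\
    in_ideal (@relF n) (f - \sum_(i < m) b i * t i).

Lemma in_kernel_relF (n : nat) (L : Type) (r : L -> word n) (f : Pol n) :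
  in_ideal (@relF n) f -> in_kernel r f.
Proof.
move=> If; exists 0%N, (fun _ => 0), (fun _ => 0); split=> [[]//|].
by rewrite big_ord0 subr0.
Qed.

Lemma in_kernel0 (n : nat) (L : Type) (r : L -> word n) : in_kernel r 0.
Proof. exact/in_kernel_relF/in_ideal0. Qed.

Lemma in_kernel_gen (n : nat) (L : Type) (r : L -> word n) (f : Pol n) :
  kernel_gen r f -> in_kernel r f.
Proof.
move=> Kf; exists 1%N, (fun _ => 1), (fun _ => f); split=> [_|].
  by split=> //; apply/sl2_fixed_inv_mod/sl2_fixed1.
by rewrite big_ord1 mul1r subrr; apply: in_ideal0.
Qed.

Lemma in_kernelD (n : nat) (L : Type) (r : L -> word n) (f h : Pol n) :
  in_kernel r f -> in_kernel r h -> in_kernel r (f + h).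
Proof.
move=> [m1 [b1 [t1 [bt1 If]]]] [m2 [b2 [t2 [bt2 Ih]]]].
exists (m1 + m2)%N, (glue_ord b1 b2), (glue_ord t1 t2); split=> [i|].
  by rewrite /glue_ord; case: split.
by rewrite sum_glue_ord opprD addrACA; apply: in_idealD.
Qed.

Lemma in_kernelM (n : nat) (L : Type) (r : L -> word n) (x f : Pol n) :
  sl2_fixed x -> in_kernel r f -> in_kernel r (x * f).
Proof.
move=> Fx [m [b [t [bt If]]]]; exists m, (fun i => x * b i), t; split=> [i|].
  have [bi ti] := bt i; split=> // g g1.
  by rewrite rmorphM /= Fx // -mulrBr; apply/in_idealMl/bi.
have -> : \sum_(i < m) x * b i * t i = x * \sum_(i < m) b i * t i.
  by rewrite mulr_sumr; apply: eq_bigr => i _; rewrite mulrA.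
by rewrite -mulrBr; apply: in_idealMl.
Qed.

Lemma in_kernel_sum (n : nat) (L : Type) (r : L -> word n) (I : Type)
    (s : seq I) (f : I -> Pol n) :
  (forall i, in_kernel r (f i)) -> in_kernel r (\sum_(i <- s) f i).
Proof. by move=> Kf; elim/big_ind: _ => //; [exact: in_kernel0 | exact: in_kernelD]. Qed.

(* The trace-ring module of words is spanned by [1], [X_i] and [X_j X_k], [j < k]. *)
Lemma word_span_ind (n : nat) (P : 'M[Pol n]_2 -> Prop) :
  (forall A B, P A -> P B -> P (A + B)) ->
  (forall x A, sl2_fixed x -> P A -> P (x *: A)) ->
  P 1%:M -> (forall i, P (Xg i)) ->
  (forall j k : 'I_n, (j < k)%N -> P (Xg j *m Xg k)) ->
  forall u : word n, P (eval_word u).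
Proof.
move=> PD PZ P1 PX PXX.
have F1 := @sl2_fixed1 n.
have PN A : P A -> P (- A).
  by move=> PA; rewrite -scaleN1r; apply: PZ => //; apply: sl2_fixedN.
have FX k : sl2_fixed (\tr (Xg k : 'M[Pol n]_2)).
  exact/is_word_trace/is_word_Xg.
have FXX j k : sl2_fixed (\tr (Xg j *m Xg k : 'M[Pol n]_2)).
  exact/is_word_trace/is_wordM/is_word_Xg/is_word_Xg.
(* Decreasing indices are swapped by polarized Cayley-Hamilton; a square reduces by Cayley-Hamilton
   itself. *)
have PXX2 j k : P (Xg j *m Xg k).
  have [|ltkj|/val_inj ->] := ltngtP j k; first exact: PXX.
    rewrite swap_mx22; apply: (PD); last exact/PN/PXX.
    apply: (PD); first by apply: (PD); apply: PZ.
    by apply: PZ => //; apply: sl2_fixedD => //; apply/sl2_fixedN/sl2_fixedM.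
  rewrite sqr_mx22; apply: (PD); first exact: PZ.
  by apply/PN/PZ => //; apply: det_Xg_fixed.
(* Inverse letters are removed through [\adj A = \tr A - A]. *)
have Padj A B : sl2_fixed (\tr A) -> P B -> P (A *m B) -> P (\adj A *m B).
  move=> FA PB PAB; rewrite adj_trace22 mulmxBl mul_scalar_mx.
  by apply: (PD); [apply: PZ | apply: PN].
have PadjR A B : sl2_fixed (\tr B) -> P A -> P (A *m B) -> P (A *m \adj B).
  move=> FB PA PAB; rewrite adj_trace22 mulmxBr mul_mx_scalar.
  by apply: (PD); [apply: PZ | apply: PN].
have Pl a : P (letter_mx a).
  rewrite /letter_mx; case: a => k [] /=; last exact: PX.
  by rewrite -[\adj _]mulmx1; apply: Padj => //; rewrite mulmx1.
have PXl j a : P (Xg j *m letter_mx a).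
  rewrite /letter_mx; case: a => k [] /=; last exact: PXX2.
  exact: PadjR.
have Pll a b : P (letter_mx a *m letter_mx b).
  rewrite {1}/letter_mx; case: a => k [] /=; last exact: PXl.
  exact: Padj.
move=> u; have [m] := ubnP (size u); elim: m u => // m IHm [|a [|b u]].
- by move=> _; rewrite eval_nil.
- by move=> _; rewrite eval_cons eval_nil mulmx1; apply: Pl.
case: u => [|c u].
  by move=> _; rewrite !eval_cons eval_nil mulmx1; apply: Pll.
(* For length at least three, [triple_mx22] is applied to the first two letters and the tail [v]:
   every product on its right side is a shorter word. *)
set v := c :: u => /ltnSE ltm.
have Fw w : sl2_fixed (\tr (eval_word w : 'M[Pol n]_2)) by apply: trw_fixed.
have Pv : P (eval_word v) by apply: IHm; apply: leq_trans ltm; rewrite ltnS leqnSn.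
have Pav x : P (letter_mx x *m eval_word v) by rewrite -eval_cons; apply: IHm.
have Fl x : sl2_fixed (\tr (letter_mx x : 'M[Pol n]_2)).
  by have := Fw [:: x]; rewrite eval_cons eval_nil mulmx1.
have Flv x : sl2_fixed (\tr (letter_mx x *m eval_word v)).
  by rewrite -eval_cons.
have Fll x y : sl2_fixed (\tr (letter_mx x *m letter_mx y : 'M[Pol n]_2)).
  by have := Fw [:: x; y]; rewrite !eval_cons eval_nil mulmx1.
have Fllv : sl2_fixed (\tr (letter_mx a *m (letter_mx b *m eval_word v))).
  by rewrite -!eval_cons.
rewrite !eval_cons.
have -> : letter_mx a *m (letter_mx b *m eval_word v) =
    embC n 2%:R^-1 *: (2%:R *: (letter_mx a *m (letter_mx b *m eval_word v))).
  rewrite scalerA -(rmorph_nat (embC n)) -rmorphM mulVf ?pnatr_eq0 //.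
  by rewrite rmorph1 scale1r.
apply: (PZ); first exact: sl2_fixedC.
have FB (x y : Pol n) : sl2_fixed x -> sl2_fixed y -> sl2_fixed (x - y).
  by move=> Fx Fy; apply/sl2_fixedD/sl2_fixedN.
rewrite triple_mx22.
have T1 := PZ _ _ (Fl a) (Pav b).
have T2 := PZ _ _ (Flv b) (Pl a).
have T3 := PZ _ _ (Fl b) (Pav a).
have T4 := PZ _ _ (sl2_fixedN (Fw v)) (Pll b a).
have T5 := PZ _ _ (FB _ _ (sl2_fixedM (Fw v) (Fl a)) (Flv a)) (Pl b).
have T6 := PZ _ _ (FB _ _ (Fll a b) (sl2_fixedM (Fl a) (Fl b))) Pv.
have T7 := PZ _ _ (FB _ _ Fllv (sl2_fixedM (Fl a) (Flv b))) P1.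
exact: (PD _ _ (PD _ _ (PD _ _ (PD _ _ (PD _ _ (PD _ _ T1 T2) T3) T4) T5) T6) T7).
Qed.

(** The map sending [A] to the trace of [A (r_l - 1)] is linear over the invariants, so the spanning
    matrices of [word_span_ind] suffice; on these it gives the listed generators. *)
Lemma in_kernel_word (n : nat) (L : Type) (r : L -> word n) (l : L) (u : word n) :
  in_kernel r (\tr (eval_word u *m (eval_word (r l) - 1%:M))).
Proof.
have trE (v : word n) : \tr (eval_word v *m (eval_word (r l) - 1%:M)) =
    trw (v ++ r l) - trw v.
  by rewrite mulmxBr mulmx1 raddfB /= -eval_cat.
pose P (A : 'M[Pol n]_2) := in_kernel r (\tr (A *m (eval_word (r l) - 1%:M))).
apply: (word_span_ind (P := P)); rewrite /P {P}.
- by move=> A B; rewrite mulmxDl mxtraceD; apply: in_kernelD.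
- by move=> x A Fx; rewrite -scalemxAl mxtraceZ; apply: in_kernelM.
- rewrite -eval_nil trE; apply: in_kernel_gen; exists l; left.
  by rewrite {2}/trw eval_nil mxtrace1.
- move=> i; have -> : Xg i = eval_word (gen i) by rewrite eval_cons eval_nil mulmx1.
  by rewrite trE; apply: in_kernel_gen; exists l; right; left; exists i.
- move=> j k ltjk.
  have -> : Xg j *m Xg k = eval_word (gen j ++ gen k).
    by rewrite eval_cat !eval_cons eval_nil !mulmx1.
  rewrite trE -catA; apply: in_kernel_gen; exists l; right; right.
  by exists j, k.
Qed.

(** This is the class of heads for [conj_avg_head]; quantifying over all words makes it stable under
    contraction. *)
Definition kernel_mx (n : nat) (L : Type) (r : L -> word n) (A : 'M[Pol n]_2) :=
  forall u : word n, in_kernel r (\tr (eval_word u *m A)).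

(** [trace_adj_swap] turns the trace of [u (\adj A) v] into that of [\adj (v u) A], and the adjugate
    of a word is a word. *)
Lemma kernel_mx_adjM (n : nat) (L : Type) (r : L -> word n) (A B : 'M[Pol n]_2) :
  kernel_mx r A -> is_word B -> kernel_mx r (\adj A *m B).
Proof.
move=> KA [v ->] u; rewrite trace_adj_swap -eval_cat -eval_word_inv; exact: KA.
Qed.

Lemma kernel_mx_trace (n : nat) (L : Type) (r : L -> word n) (A : 'M[Pol n]_2) :
  kernel_mx r A -> in_kernel r (\tr A).
Proof. by move=> /(_ [::]); rewrite eval_nil mul1mx. Qed.

Lemma kernel_mx_relator (n : nat) (L : Type) (r : L -> word n) (l : L) :
  kernel_mx r (eval_word (r l) - 1%:M).
Proof. by move=> u; apply: in_kernel_word. Qed.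

Lemma act_relator (n : nat) (g : 'M[CC]_2) (u : word n) (i j : 'I_2) : \det g = 1 ->
  act g ((eval_word u - 1%:M) i j) =
  (emb n g *m (eval_word u - 1%:M) *m \adj (emb n g)) i j.
Proof.
move=> g1; have [gV _] := mul_emb_adj n g1.
rewrite mulmxBr mulmxBl mulmx1 gV -(act_eval _ g1) -(map_mx1 (act g)) -map_mxB.
by rewrite map_mx1 [in RHS]mxE.
Qed.

(** The relator entry is the head, and the monomials of [c] supply the word factors. Their degree is
    strictly below [msize c], which leaves room for the head within the exactness bound. *)
Lemma in_kernel_reynolds_entry (n N : nat) (L : Type) (r : L -> word n) (l : L)
    (T : finType) (w : T -> CCnum) (g : T -> 'M[CCnum]_2) (c : Pol n) (i j : 'I_2) :
  haar_exact w g N -> (forall a, \det (g a) = 1) -> (msize c <= N)%N ->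
  in_kernel r (reynolds w g (c * (eval_word (r l) - 1%:M) i j)).
Proof.
move=> wgN g1 lecN; rewrite [c]mpolyE mulr_suml reynolds_sum big_seq.
apply: (big_ind (in_kernel r)) => [|? ?|m mc]; [exact: in_kernel0 | exact: in_kernelD |].
rewrite -scalerAl reynoldsZ; apply: in_kernelM; first exact: sl2_fixedC.
have [s [sz Ws sE]] := act_entries_monomial m.
have -> : reynolds w g ('X_[m] * (eval_word (r l) - 1%:M) i j) =
    conj_avg (embC n) w g ((eval_word (r l) - 1%:M, i, j) :: s).
  apply: eq_bigr => a _; congr (_ * _).
  by rewrite rmorphM /= sE big_cons mulrC act_relator.
apply: (conj_avg_head wgN (@sl2_fixedD n) (@sl2_fixedM n) (@sl2_fixedC n)
  (@is_wordM n) (@is_word_adj n) (@is_word_trace n) (@in_kernelD n L r)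
  (@in_kernel0 n L r) (@in_kernelM n L r) (@kernel_mx_adjM n L r)
  (@kernel_mx_trace n L r) _ _ (@kernel_mx_relator n L r l) Ws).
by rewrite sz (leq_trans _ lecN) // msize_mdeg_lt.
Qed.

Lemma kernel_gen_relG (n : nat) (L : Type) (r : L -> word n) (f : Pol n) :
  kernel_gen r f -> in_ideal (relG r) f.
Proof.
have trE (u : word n) l : in_ideal (relG r) (trw (u ++ r l) - trw u).
  have -> : trw (u ++ r l) - trw u = \tr (eval_word u *m (eval_word (r l) - 1%:M)).
    by rewrite mulmxBr mulmx1 raddfB /= -eval_cat.
  apply: in_ideal_sum => i; rewrite mxE; apply: in_ideal_sum => j.
  by apply/in_idealMl/in_ideal_gen; right; exists l, j, i.
move=> [l [->|[[i ->]|[j [k [_ ->]]]]]].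
- by have := trE [::] l; rewrite {2}/trw eval_nil mxtrace1.
- exact: trE.
- by rewrite catA; apply: trE.
Qed.

Unset Implicit Arguments.

(* B(F_n) -> B(Gamma), [f] |-> [f], is surjective, and its kernel is the ideal of
   B(F_n) generated by the classes of the kernel_gen elements. *)
Theorem theorem1 (n : nat) (L : Type) (r : L -> word n) :
  (forall f : Pol n, inv_mod (relG r) f ->
     exists f' : Pol n, inv_mod (@relF n) f' /\ in_ideal (relG r) (f - f'))
  /\
  (forall f : Pol n, inv_mod (@relF n) f ->
     (in_ideal (relG r) f <->
      exists (m : nat) (b t : 'I_m -> Pol n),
        (forall i, inv_mod (@relF n) (b i) /\ kernel_gen r (t i)) /\
        in_ideal (@relF n) (f - \sum_(i < m) b i * t i))).
Proof.
have relFG (x : Pol n) : relF x -> relG r x by left.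
(* The total weight is the moment of the constant function 1. *)
have w1 N (T : finType) (w : T -> CCnum) g : haar_exact w g N -> \sum_a w a = 1.
  move=> /(_ 0 0 0 0 isT)%N; rewrite /haar_moment /haar_value mul1r.
  by under eq_bigr do rewrite !mulr1; rewrite mul1r divr1.
split=> f If.
  have [T [w [g [g1 wgN]]]] := haar_quadrature CCnum (msize f).
  exists (reynolds w g f); split.
    exact/sl2_fixed_inv_mod/(reynolds_fixed wgN).
  exact: (reynolds_ideal g1 (w1 _ _ _ _ wgN) If).
split=> [[m [c [s [Ss fE]]]]|[m [b [t [bt Ift]]]]]; last first.
  rewrite -[f](subrK (\sum_(i < m) b i * t i)).
  apply: in_idealD; first exact: in_ideal_le Ift.
  by apply: in_ideal_sum => i; apply/in_idealMl/kernel_gen_relG; have [] := bt i.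
(* One quadrature must serve all coefficients of the chosen expression of [f] over [relG]. *)
pose N := \max_i msize (c i).
have [T [w [g [g1 wgN]]]] := haar_quadrature CCnum N.
(* The difference of [f] and its average lies in the ideal of [relF], [f] being invariant modulo it;
   the average is then expanded along [fE]. *)
rewrite -[f](subrK (reynolds w g f)); apply: in_kernelD.
  exact/in_kernel_relF/(reynolds_ideal g1 (w1 _ _ _ _ wgN) If).
rewrite {1}fE reynolds_sum; apply: in_kernel_sum => i.
have [[k ->]|[l [p [q ->]]]] := Ss i.
  (* The generator [\det (Xg k) - 1] is invariant and comes out of the average. *)
  rewrite reynoldsMr //; first by apply/in_kernel_relF/in_idealMl/in_ideal_gen; exists k.
  apply: sl2_fixedD; first exact: det_Xg_fixed.
  exact/sl2_fixedN/sl2_fixed1.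
apply: (in_kernel_reynolds_entry _ _ _ _ wgN g1).
exact: leq_bigmax.
Qed.
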